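(* Let $(a_n)_{n\ge 1}$ be a sequence with $a_n\ge 0$ for all $n$. For $0<p\le 1/2$, $$\sum_{n=1}^{\infty}\Big(\sum_{k=n}^{\infty}\ln\Big(\frac{k+1}{k}\Big)a_k\Big)^p\ \ge\ p^p\sum_{n=1}^{\infty}a_n^p .$$ The constant $p^p$ is best possible.
   Context: All sums have nonnegative terms and take values in $[0,+\infty]$, with $(+\infty)^p=+\infty$ for $p>0$. ''Best possible'' means that, for the given $p$, the constant cannot be replaced by a larger one so that the inequality still holds for all nonnegative sequences $(a_n)$. *)

(* Defs.v *)
From HB Require Import structures.
From mathcomp Require Export all_boot all_order all_algebra.
From mathcomp Require Export all_classical all_reals all_analysis.

Set Implicit Arguments.
Unset Strict Implicit.
Unset Printing Implicit Defensive.

Import Order.TTheory GRing.Theory Num.Theory.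
Import numFieldNormedType.Exports.

Local Open Scope ereal_scope.

(* A sequence (a_n) indexed by n >= 1 is a function nat -> R whose value at 0
   is never constrained nor used.  All sums are in the extended reals: the
   inner one may be +oo, and then so is its p-th power, since p > 0. *)
Definition log_copson_ineq (R : realType) (p c : R) (a : nat -> R) : Prop :=
  \sum_(1 <= n <oo)
     (\sum_(n <= k <oo) (ln (k.+1%:R / k%:R) * a k)%:E) `^ p
  >= c%:E * \sum_(1 <= n <oo) (a n `^ p)%:E.

(* Main.v *)
(* Write [l_n = ln (1 + 1/n)] and let [A_n] be the inner tail sums, so that
   [l_n a_n = A_n - A_(n+1)].  Both sides are compared through the local inequality
     [p^p a_n^p <= A_n^p + p (n-1) A_n^p - p n A_(n+1)^p],
   which telescopes.  By Hoelder's inequality with exponents [1/(1-p)] and [1/p]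
   it reduces to a numerical one, which with [e = p/(1-p)], [q = 1/(1-p)] and
   [m = e n] reads [(1+m)^q - m^q >= q (e / l_n)^e].  This follows from
   [l_n >= e ln (1 + 1/m)], which is where [e <= 1], i.e. [p <= 1/2], is used,
   and from Jensen's inequality.

   For optimality, take [a_n] for [n <= N] such that
   [A_n = n^(-1/p) - (N+1)^(-1/p)], and [a_n = 0] for [n > N]: then
   [A_n^p <= 1/n] while [a_n^p >= p^(-p) / (n+1)], and the harmonic series
   diverges. *)
Require Import Defs.
From mathcomp Require Import all_boot all_order all_algebra.
From mathcomp Require Import all_classical all_reals all_analysis.
From mathcomp Require Import ring lra.

Set Implicit Arguments.
Unset Strict Implicit.
Unset Printing Implicit Defensive.

Import Order.TTheory GRing.Theory Num.Theory.
Import numFieldNormedType.Exports.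
Local Open Scope classical_set_scope.
Local Open Scope ring_scope.

(** * Bernoulli and Jensen inequalities for real powers *)

(** Young's inequality for the product x * 1 with exponents q and q / (q - 1), multiplied by q. *)
Lemma powR_bernoulli_ge (R : realType) (q x : R) :
  1 < q -> 0 <= x -> 1 + q * (x - 1) <= x `^ q.
Proof.
move=> q1 x0.
have q0 : 0 < q by lra.
have r0 : 0 < q / (q - 1) by rewrite divr_gt0//; lra.
have qr : q^-1 + (q / (q - 1))^-1 = 1 by field; lra.
have := conjugate_powR x0 ler01 q0 r0 qr.
rewrite powR1 mulr1 -(ler_pM2r q0) mulrDl divfK ?gt_eqF//.
have -> : 1 / (q / (q - 1)) * q = q - 1 by field; lra.
lra.
Qed.

(** For e < 1 this is [powR_bernoulli_ge] with exponent 1/e at the point x^e. *)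
Lemma powR_bernoulli_le (R : realType) (e x : R) :
  0 < e -> e <= 1 -> 0 <= x -> x `^ e <= 1 + e * (x - 1).
Proof.
move=> e0; rewrite le_eqVlt => /predU1P[-> x0|e1 x0].
  by rewrite powRr1//; lra.
have ei1 : 1 < e^-1 by rewrite invf_gt1.
have := @powR_bernoulli_ge R e^-1 (x `^ e) ei1 (powR_ge0 _ _).
rewrite -powRrM mulfV ?gt_eqF// powRr1// -(ler_pM2l e0) mulrDr mulrA.
by rewrite mulfV ?gt_eqF//; lra.
Qed.

(* Jensen's inequality for [z |-> z `^ q] applied to [s |-> expR (h * s)] on
   [0, 1], proved by integrating the tangent line at the mean value [c]. *)
Lemma expR_jensen (R : realType) (h q : R) : 0 < h -> 1 < q ->
  h * q * ((expR h - 1) / h) `^ q <= expR (h * q) - 1.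
Proof.
move=> h0 q1; set c := (_ / h).
have c0 : 0 < c by rewrite divr_gt0// subr_gt0 expR_gt1.
pose t := c `^ q.
(* With z = exp(h s), [dphi] is h q times the gap between z^q and its tangent line at [c]. [phi] is
   an antiderivative of it, so the mean value theorem stands in for the integral. *)
pose phi s := expR (h * q * s) - q ^+ 2 * (t / c) * expR (h * s)
               + h * q * (q - 1) * t * s.
pose dphi s := h * q * (expR (h * q * s) - t * (1 + q * (expR (h * s) / c - 1))).
have dphiE (s : R) : is_derive s (1 : R) phi (dphi s).
  rewrite /phi; apply: is_derive_eq.
  rewrite /GRing.scale/= /dphi; field; lra.
have phi_cont : {within `[0, 1], continuous phi}.
  by apply: continuous_subspaceT => s; apply/differentiable_continuous/derivable1_diffP.
have [s _ phiE] := @MVT_segment R phi dphi 0 1 ler01 (fun s _ => dphiE s) phi_cont.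
have : 0 <= phi 1 - phi 0.
  have ratio_ge0 : 0 <= expR (h * s) / c.
    by apply: divr_ge0; [exact: expR_ge0|exact: ltW].
  rewrite phiE subr0 mulr1 /dphi mulr_ge0//; first by nra.
  have -> : expR (h * q * s) = t * (expR (h * s) / c) `^ q.
    rewrite -powRM ?ratio_ge0 ?(ltW c0)//.
    rewrite mulrCA divff ?gt_eqF// mulr1 /powR gt_eqF ?expR_gt0// expRK.
    by congr expR; ring.
  rewrite -mulrBr mulr_ge0 ?powR_ge0// subr_ge0.
  exact: powR_bernoulli_ge.
rewrite /phi !mulr0 !mulr1 expR0 -/t.
have -> : expR h = 1 + h * c by rewrite /c; field; lra.
suff -> : expR (h * q) - q ^+ 2 * (t / c) * (1 + h * c) + h * q * (q - 1) * t -
   (1 - q ^+ 2 * (t / c) * 1 + 0) = expR (h * q) - 1 - h * q * t by lra.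
by field; lra.
Qed.

(** This is [expR_jensen] at h = ln(1 + 1/m), where exp(h) - 1 = 1/m, multiplied by m^q. Here 1/h is
    the logarithmic mean of m and m + 1. *)
Lemma powR_increment_ge (R : realType) (q m : R) : 1 < q -> 0 < m ->
  q * (ln (1 + m^-1))^-1 `^ (q - 1) <= (1 + m) `^ q - m `^ q.
Proof.
move=> q1 m0; set h := ln _.
have m1 : 0 < m^-1 by rewrite invr_gt0.
have h0 : 0 < h by rewrite ln_gt0//; lra.
have := expR_jensen h0 q1.
have -> : expR (h * q) = (1 + m^-1) `^ q.
  by rewrite /powR gt_eqF 1?mulrC//; lra.
rewrite lnK ?posrE; last by lra.
rewrite [1 + _ - 1]addrC addKr -(ler_pM2r (powR_gt0 q m0)) mulrBl mul1r.
have -> : (1 + m^-1) `^ q * m `^ q = (1 + m) `^ q.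
  by rewrite -powRM; [congr powR; field|..]; lra.
have -> : h * q * (m^-1 / h) `^ q * m `^ q = h * q * (h^-1) `^ q.
  rewrite -mulrA -powRM ?mulr_ge0 ?invr_ge0 ?ltW//.
  by congr (_ * _ `^ _); field; lra.
rewrite -[h^-1 `^ q]mulr_powRB1 ?invr_ge0 ?(ltW h0) ?(lt_trans ltr01 q1)//.
by rewrite mulrA (mulrC h) mulfK ?gt_eqF.
Qed.

(** * The local inequality *)

(** The condition on the weights that Hoelder's inequality leaves in [copson_step]. *)
Lemma copson_weights_le (R : realType) (p x : R) :
  0 < p -> p <= 1 / 2 -> 1 <= x ->
  (p * x) `^ (1 - p)^-1 + (p / ln (1 + x^-1)) `^ (p / (1 - p))
    <= (1 + p * (x - 1)) `^ (1 - p)^-1.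
Proof.
move=> p0 p12 x1; set l := ln _; set q := _^-1; set e := p / (1 - p).
have e0 : 0 < e by rewrite divr_gt0//; lra.
have e1 : e <= 1 by rewrite ler_pdivrMr; lra.
have eE : e = q - 1 by rewrite /e /q; field; lra.
have q1 : 1 < q by lra.
have q0 : 0 < q by lra.
pose m := e * x.
have m0 : 0 < m by rewrite mulr_gt0//; lra.
have l0 : 0 < l by rewrite ln_gt0// ltrDl invr_gt0; lra.
pose h := ln (1 + m^-1).
have h0 : 0 < h by rewrite ln_gt0// ltrDl invr_gt0.
(* After exponentiation: (1 + 1/m)^e <= 1 + e/m = 1 + 1/x, by Bernoulli's inequality for an exponent
   e <= 1. *)
have hl : e * h <= l.
  rewrite -ln_powR ler_ln ?posrE ?powR_gt0 ?ltr_wpDr ?invr_ge0 ?ltr01//; [|lra..].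
  apply: le_trans (powR_bernoulli_le e0 e1 _) _; first by rewrite addr_ge0 ?invr_ge0 ?ltW.
  by rewrite lerD2l addrC addKr /m invfM mulrA mulfV ?gt_eqF// mul1r.
(* Each base contains the factor 1/q. Since e = q - 1, all three terms then share the factor q^(-q),
   up to an extra q in the middle one. *)
have -> : p * x = q^-1 * m by rewrite /m /e /q; field; lra.
have -> : 1 + p * (x - 1) = q^-1 * (1 + m) by rewrite /m /e /q; field; lra.
have -> : p / l = q^-1 * (e / l) by rewrite /e /q; field; lra.
clearbody m; clearbody e q l.
rewrite !powRM ?invr_ge0 ?(ltW q0) ?(ltW m0) ?divr_ge0 ?(ltW e0) ?(ltW l0)
  ?addr_ge0 ?(ltW m0)//.
have -> : q^-1 `^ e = q^-1 `^ q * q.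
  rewrite -(@mulr_powRB1 _ q^-1 q) ?invr_gt0// ?invr_ge0 ?(ltW q0)//.
  by rewrite -eE mulrAC mulVf ?gt_eqF// mul1r.
rewrite -mulrA -mulrDr ler_pM2l ?powR_gt0 ?invr_gt0// -lerBrDl.
apply: le_trans (powR_increment_ge q1 m0).
rewrite -eE -/h ler_pM2l// -powRM ?invr_ge0 ?(ltW e0) ?(ltW l0)//.
apply: ge0_ler_powR; rewrite ?nnegrE ?divr_ge0 ?invr_ge0 ?(ltW e0) ?(ltW l0) ?(ltW h0)//.
by rewrite ler_pdivrMr// mulrC ler_pdivlMr.
Qed.

(** Hoelder is applied to p x * B^p + (p/l)^p * (A - B)^p. The second factors combine to (B + (A -
    B))^p = A^p, and the first ones are bounded by [copson_weights_le]. *)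
Lemma copson_step (R : realType) (p x A B : R) :
  0 < p -> p <= 1 / 2 -> 1 <= x -> 0 <= B -> B <= A ->
  p `^ p * ((A - B) / ln (1 + x^-1)) `^ p
    <= A `^ p + (p * (x - 1) * A `^ p - p * x * B `^ p).
Proof.
move=> p0 p12 x1 B0 BA; set l := ln _.
have l0 : 0 < l by rewrite ln_gt0// ltrDl invr_gt0; lra.
have px0 : 0 <= p * x by rewrite mulr_ge0//; lra.
have w0 : 0 <= 1 + p * (x - 1) by rewrite addr_ge0 ?mulr_ge0 ?subr_ge0// ltW.
have AB0 : 0 <= A - B by rewrite subr_ge0.
have q0 : 0 < (1 - p)^-1 by rewrite invr_gt0; lra.
have := @hoelder2 R (p * x) ((p / l) `^ p) (B `^ p) ((A - B) `^ p) (1 - p)^-1 p^-1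
  px0 (powR_ge0 _ _) (powR_ge0 _ _) (powR_ge0 _ _) q0.
rewrite invr_gt0 !invrK subrK -!powRrM mulfV ?gt_eqF// !powRr1// subrKC.
move=> /(_ p0 erefl) holder.
have : ((p * x) `^ (1 - p)^-1 + (p / l) `^ (p / (1 - p))) `^ (1 - p) <= 1 + p * (x - 1).
  have -> : 1 + p * (x - 1) = (1 + p * (x - 1)) `^ (1 - p)^-1 `^ (1 - p).
    by rewrite -powRrM mulVf ?powRr1// gt_eqF//; lra.
  apply: ge0_ler_powR; rewrite ?nnegrE ?[_ <= _ + _ `^ _]addr_ge0 ?powR_ge0//.
    by lra.
  exact: copson_weights_le.
move=> /(ler_wpM2r (powR_ge0 A p)) /(le_trans holder).
have -> : (p / l) `^ p * (A - B) `^ p = p `^ p * ((A - B) / l) `^ p.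
  by rewrite -!powRM ?divr_ge0 ?(ltW p0) ?(ltW l0)// mulrA mulrAC.
lra.
Qed.

(** * Summation of the local inequality *)

Lemma copson_partial_sum (R : realType) (p : R) (A a : nat -> R) (N : nat) :
  0 < p -> p <= 1 / 2 ->
  (forall n, (1 <= n)%N -> 0 <= A n) ->
  (forall n, (1 <= n)%N -> 0 <= a n) ->
  (forall n, (1 <= n)%N -> A n = ln (n.+1%:R / n%:R) * a n + A n.+1) ->
  p `^ p * \sum_(1 <= n < N.+1) a n `^ p + p * N%:R * A N.+1 `^ p
    <= \sum_(1 <= n < N.+1) A n `^ p.
Proof.
move=> p0 p12 A0 a0 AE; elim: N => [|N IH].
  by rewrite !big_geq// !(mulr0, mul0r) addr0.
rewrite big_nat_recr// [leRHS]big_nat_recr//= mulrDr.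
have N1 : 1 <= N.+1%:R :> R by rewrite ler1n.
have lE : N.+2%:R / N.+1%:R = 1 + N.+1%:R^-1 :> R.
  by rewrite -natr1 mulrDl divff ?gt_eqF ?mul1r// ltr0n.
have l0 : 0 < ln (1 + N.+1%:R^-1) :> R by rewrite ln_gt0// ltrDl invr_gt0 ltr0n.
have AE' := AE N.+1 isT; rewrite lE in AE'.
have AA : A N.+2 <= A N.+1 by rewrite AE' lerDr mulr_ge0 ?a0// ltW.
have := copson_step p0 p12 N1 (A0 N.+2 isT) AA.
have -> : (A N.+1 - A N.+2) / ln (1 + N.+1%:R^-1) = a N.+1.
  by rewrite AE' addrK mulrC mulKf ?gt_eqF.
have -> : N.+1%:R - 1 = N%:R :> R by rewrite -natr1 addrK.
lra.
Qed.

Lemma ln_succ_ratio_ge0 (R : realType) (k : nat) : 0 <= ln (k.+1%:R / k%:R : R).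
Proof.
(* At 0 both the inverse and the logarithm take the default value 0. *)
case: k => [|k]; first by rewrite invr0 mulr0 ln0.
by rewrite ln_ge0// ler_pdivlMr ?mul1r ?ler_nat ?ltr0n.
Qed.

Lemma log_copson (R : realType) (p : R) (a : nat -> R) :
  0 < p -> p <= 1 / 2 -> (forall n, (1 <= n)%N -> 0 <= a n) ->
  log_copson_ineq p (p `^ p) a.
Proof.
move=> p0 p12 a0; rewrite /log_copson_ineq.
pose u k := (ln (k.+1%:R / k%:R) * a k)%:E.
pose T n := (\sum_(n <= k <oo) u k)%E.
have u0 k : (1 <= k)%N -> (0 <= u k)%E.
  by move=> k1; rewrite lee_fin mulr_ge0 ?a0 ?ln_succ_ratio_ge0.
have T0 n : (1 <= n)%N -> (0 <= T n)%E.
  by move=> n1; apply: nneseries_ge0 => k nk _; rewrite u0 ?(leq_trans n1).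
have TS n : (1 <= n)%N -> T n = (u n + T n.+1)%E.
  move=> n1; rewrite /T (nneseries_split n 1) ?addn1 ?big_nat1//.
  by move=> k nk; rewrite u0 ?(leq_trans n1).
have Tp0 n : (1 <= n)%N -> xpredT n -> (0 <= T n `^ p)%E by rewrite poweR_ge0.
(* If the first tail is infinite, the first outer term already makes the larger side infinite.
   Otherwise every tail is finite and the real-valued lemma applies. *)
have [T1y|T1y] := eqVneq (T 1%N) +oo%E.
  apply: (@le_trans _ _ +oo%E); first exact: leey.
  apply: le_trans (nneseries_lim_ge 2 Tp0).
  by rewrite big_nat1 T1y poweRyr// gt_eqF.
have Tfin n : (1 <= n)%N -> T n \is a fin_num.
  elim: n => [//|[_ _|n IH _]].
    by rewrite ge0_fin_numE ?T0// lt_neqAle T1y leey.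
  by have := IH isT; rewrite TS// fin_numD => /andP[].
pose A n := fine (T n).
have TA n : (1 <= n)%N -> T n = (A n)%:E by move=> n1; rewrite fineK ?Tfin.
have AE n : (1 <= n)%N -> A n = ln (n.+1%:R / n%:R) * a n + A n.+1.
  by move=> n1; apply/EFin_inj; rewrite EFinD -!TA// TS.
have A0 n : (1 <= n)%N -> 0 <= A n by move=> n1; rewrite fine_ge0 ?T0.
rewrite -nneseriesZl; last by move=> n _; rewrite lee_fin powR_ge0.
apply: lime_le.
  by apply: is_cvg_nneseries => n _ _; rewrite mule_ge0 ?lee_fin ?powR_ge0.
apply: nearW => M; apply: le_trans (nneseries_lim_ge M Tp0).
case: M => [|N]; first by rewrite !big_geq.
rewrite [leRHS](eq_big_nat _ _ (F2 := fun n => (A n `^ p)%:E)); last first.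
  by move=> n /andP[/TA TnE _]; rewrite -[LHS]/(T n `^ p)%E TnE.
rewrite [leLHS](eq_bigr (fun n => (p `^ p * a n `^ p)%:E))//.
rewrite !sumEFin -mulr_sumr lee_fin.
apply: le_trans (copson_partial_sum N p0 p12 A0 a0 AE).
by rewrite lerDl !mulr_ge0 ?powR_ge0// ltW.
Qed.

(** * Optimality of the constant *)

(** From exp(y) >= 1 + y at y = s ln((n+1)/n), multiplied by (n+1)^(-s). With s = 1/p it bounds the
    test sequence from below. *)
Lemma powRN_increment_ge (R : realType) (s : R) (n : nat) : 0 < s -> (1 <= n)%N ->
  s * n.+1%:R `^ (- s) * ln (n.+1%:R / n%:R) <= n%:R `^ (- s) - n.+1%:R `^ (- s).
Proof.
move=> s0 n1; have n0 : 0 < n%:R :> R by rewrite ltr0n.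
have r0 : 0 < n.+1%:R / n%:R :> R by rewrite divr_gt0.
have : 1 + s * ln (n.+1%:R / n%:R) <= (n.+1%:R / n%:R : R) `^ s.
  by rewrite /powR gt_eqF// expR_ge1Dx.
rewrite -(ler_pM2r (powR_gt0 (- s) (ltr0Sn R n))).
have -> : (n.+1%:R / n%:R : R) `^ s * n.+1%:R `^ (- s) = n%:R `^ (- s).
  rewrite powRM ?invr_ge0 ?ler0n// mulrAC -powRD ?subrr ?powRr0 ?mul1r.
    by rewrite powRN -powR_inv1 ?ler0n// -powRrM mulN1r powRN.
  by rewrite pnatr_eq0 implybT.
lra.
Qed.

Lemma log_copson_harmonic (R : realType) (p c : R) (N : nat) : 0 < p -> 0 <= c ->
  (forall a : nat -> R, (forall n, (1 <= n)%N -> 0 <= a n) ->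
     log_copson_ineq p c a) ->
  c / p `^ p * \sum_(1 <= n < N.+1) n.+1%:R^-1 <= \sum_(1 <= n < N.+1) n%:R^-1.
Proof.
move=> p0 c0 ineq.
pose s := p^-1; have s0 : 0 < s by rewrite invr_gt0.
pose b n : R := n%:R `^ (- s).
pose l n : R := ln (n.+1%:R / n%:R).
have l0 n : (1 <= n)%N -> 0 < l n.
  by move=> n1; rewrite ln_gt0// ltr_pdivlMr ?mul1r ?ltr_nat ?ltr0n.
have bpow n : b n `^ p = n%:R^-1.
  by rewrite /b -powRrM mulNr mulVf ?gt_eqF// powR_inv1.
(* Dividing by [l n] makes the tails telescope to [b n - b N.+1]; the cutoff at [N] reduces both
   series to finite sums. *)
pose a n := if (n <= N)%N then (b n - b n.+1) / l n else 0.
have a_ge n : (1 <= n <= N)%N -> s * b n.+1 <= a n.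
  by move=> /andP[n1 nN]; rewrite /a nN ler_pdivlMr ?l0//; exact: powRN_increment_ge.
have a0 n : (1 <= n)%N -> 0 <= a n.
  move=> n1; have [nN|nN] := leqP n N; last by rewrite /a leqNgt nN.
  by apply: le_trans (a_ge n _); rewrite ?n1// mulr_ge0 ?powR_ge0 ?ltW.
have la n : (1 <= n)%N -> l n * a n = if (n <= N)%N then b n - b n.+1 else 0.
  by move=> n1; rewrite /a; case: ifP => _; rewrite ?mulr0// mulrC divfK ?gt_eqF ?l0.
have tail0 n : (N < n)%N -> (\sum_(n <= k <oo) (l k * a k)%:E = 0)%E.
  move=> Nn; apply: eseries0 => k nk _.
  by rewrite /a leqNgt (leq_trans Nn nk) mulr0.
have tail n : (1 <= n)%N -> (n <= N)%N ->
    (\sum_(n <= k <oo) (l k * a k)%:E = (b n - b N.+1)%:E)%E.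
  move=> n1 nN; rewrite (nneseries_split n (N.+1 - n)); last first.
    by move=> k nk; rewrite lee_fin mulr_ge0 ?ln_succ_ratio_ge0 ?a0 ?(leq_trans n1).
  rewrite subnKC ?(leqW nN)// tail0// adde0 sumEFin; congr EFin.
  rewrite (eq_big_nat _ _ (F2 := fun k => - (b k.+1 - b k))); last first.
    by move=> k /andP[nk kN]; rewrite la ?(leq_trans n1)// -ltnS kN opprB.
  by rewrite sumrN telescope_sumr ?opprB// leqW.
have := ineq a a0; rewrite /log_copson_ineq => {}ineq.
have upper : (\sum_(1 <= n <oo) (\sum_(n <= k <oo) (l k * a k)%:E) `^ p
    <= (\sum_(1 <= n < N.+1) n%:R^-1)%:E)%E.
  rewrite (nneseries_split 1 N); last by move=> *; exact: poweR_ge0.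
  rewrite [X in (_ + X)%E]eseries0 ?adde0; last first.
    by move=> n Nn _; rewrite tail0// poweR0r ?gt_eqF.
  rewrite add1n -sumEFin big_nat [leRHS]big_nat lee_sum// => n /andP[n1 nN].
  have bN0 : 0 <= b n - b N.+1.
    rewrite -lee_fin -tail// nneseries_ge0// => k nk _.
    by rewrite lee_fin mulr_ge0 ?ln_succ_ratio_ge0 ?a0 ?(leq_trans n1).
  rewrite tail// lee_fin -bpow.
  apply: ge0_ler_powR; rewrite ?nnegrE ?powR_ge0 ?(ltW p0)//.
  by rewrite lerBlDr lerDl powR_ge0.
have lower : (((p `^ p)^-1 * \sum_(1 <= n < N.+1) n.+1%:R^-1)%:E
    <= \sum_(1 <= n <oo) (a n `^ p)%:E)%E.
  apply: (le_trans _ (nneseries_lim_ge N.+1 _)) => [|n _ _]; last first.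
    by rewrite lee_fin powR_ge0.
  rewrite sumEFin lee_fin mulr_sumr big_nat [leRHS]big_nat ler_sum// => n n1N.
  have -> : (p `^ p)^-1 * n.+1%:R^-1 = (s * b n.+1) `^ p.
    rewrite powRM ?powR_ge0 ?(ltW s0)// bpow; congr (_ * _).
    by rewrite /s -powRN -(powR_inv1 (ltW p0)) -powRrM mulN1r.
  apply: ge0_ler_powR; rewrite ?nnegrE ?a_ge ?mulr_ge0 ?powR_ge0 ?(ltW p0) ?(ltW s0)//.
  by rewrite a0//; case/andP: n1N.
rewrite -lee_fin -mulrA EFinM.
by apply: le_trans (le_trans ineq upper); rewrite lee_wpmul2l.
Qed.

Lemma harmonic_sum_unbounded (R : realType) (M : R) :
  exists N : nat, M < \sum_(1 <= n < N.+1) n%:R^-1.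
Proof.
apply: contrapT => /forallNP bounded; apply: (@dvg_harmonic R).
apply: nondecreasing_is_cvgn.
  by apply: nondecreasing_series => n _ _; exact: harmonic_ge0.
(* The sequence [harmonic] starts at index 0 with terms 1/(n+1), hence the shift. *)
exists M => _ [N _ <-]; rewrite /series/= -(big_add1 _ _ 0 N.+1 xpredT (fun n => n%:R^-1)).
by rewrite leNgt; apply/negP/bounded.
Qed.

Theorem corollary1p2 (R : realType) (p : R) (p_gt0 : 0 < p)
    (p_le_half : p <= 1 / 2) :
  (forall a : nat -> R, (forall n : nat, (1 <= n)%N -> 0 <= a n) ->
     log_copson_ineq p (p `^ p) a) /\
  (forall c : R, p `^ p < c ->
     ~ (forall a : nat -> R, (forall n : nat, (1 <= n)%N -> 0 <= a n) ->
          log_copson_ineq p c a)).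
Proof.
split=> [a a0|c pc ineq]; first exact: log_copson.
have pp0 : 0 < p `^ p by rewrite powR_gt0.
have c0 : 0 <= c by rewrite ltW// (lt_trans pp0).
pose K := c / p `^ p.
have K1 : 1 < K by rewrite ltr_pdivlMr ?mul1r.
(* With H the harmonic sum and H' its shift, K H' <= H and H - 1 <= H' give K (H - 1) <= H, that is
   H <= K / (K - 1). This [N] violates that bound. *)
have [N HN] := @harmonic_sum_unbounded R (K / (K - 1)).
have shift : \sum_(1 <= n < N.+1) n%:R^-1 + N.+1%:R^-1
    = 1 + \sum_(1 <= n < N.+1) n.+1%:R^-1 :> R.
  elim: (N) => [|M IH]; first by rewrite !big_geq// add0r addr0 invr1.
  by rewrite big_nat_recr// [in RHS]big_nat_recr//= IH addrA.
have inv0 : 0 <= N.+1%:R^-1 :> R by rewrite invr_ge0.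
have := log_copson_harmonic N p_gt0 c0 ineq.
move: shift HN; rewrite -/K ltr_pdivrMr ?subr_gt0//.
set H := \sum_(1 <= n < _) n%:R^-1; set H' := \sum_(1 <= n < _) _ => shift HN KH.
have HH' : H - 1 <= H' by rewrite lerBlDl -shift lerDl.
have : K * (H - 1) <= K * H' by rewrite ler_pM2l// (lt_trans ltr01).
lra.
Qed.
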